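(* $\mathsf{D}^2<\mathsf{IF}^2$, and this holds already in the finite. That is: for every sentence $\phi$ of $\mathsf{D}^2$ there is a sentence $\phi^*$ of $\mathsf{IF}^2$ such that for all structures $\mathfrak{A}$, $\mathfrak{A}\models\phi$ iff $\mathfrak{A}\models\phi^*$; there is a sentence of $\mathsf{IF}^2$ that is not equivalent, over all structures, to any sentence of $\mathsf{D}^2$; and there is a sentence of $\mathsf{IF}^2$ that is not equivalent, over all finite structures, to any sentence of $\mathsf{D}^2$.
   Context: Syntax, over a relational vocabulary $\tau$ whose symbols are at most binary. Fix variables $x,y$. Formulas of $\mathsf{D}^2(\tau)$ (two-variable dependence logic) are generated by $\phi::= t_1=t_2\mid R(t_1,\dots,t_n)\mid \neg t_1=t_2\mid \neg R(t_1,\dots,t_n)\mid =\!(t_1,t_2)\mid \neg =\!(t_1,t_2)\mid =\!(t_1)\mid\neg =\!(t_1)\mid(\phi\wedge\phi)\mid(\phi\vee\phi)\mid\forall x\phi\mid\forall y\phi\mid\exists x\phi\mid\exists y\phi$. Formulas of $\mathsf{IF}^2(\tau)$ (two-variable independence-friendly logic) are generated by $\phi::= t_1=t_2\mid R(t_1,\dots,t_n)\mid \neg t_1=t_2\mid \neg R(t_1,\dots,t_n)\mid(\phi\wedge\phi)\mid(\phi\vee\phi)\mid\forall x\phi\mid\forall y\phi\mid\exists x/W\phi\mid\exists y/W\phi$. Here $R\in\tau$ is $n$-ary, $t_1,\dots,t_n\in\{x,y\}$ and $W\subseteq\{x,y\}$; $\exists x/\emptyset\,\phi$ is identified with $\exists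 x\phi$. Free variables $\mathrm{Fr}(\phi)$ are defined as in first-order logic, with $\mathrm{Fr}(=\!(t_1,\dots,t_n))$ the set of variables occurring in $t_1,\dots,t_n$ and $\mathrm{Fr}(\exists v/W\psi)=W\cup(\mathrm{Fr}(\psi)\setminus\{v\})$. A sentence is a formula with no free variables. Teams. A team $X$ of $\mathfrak{A}$ (domain $A$) with domain $\mathrm{dom}(X)=\{x_1,\dots,x_k\}$ (possibly empty) is any set of assignments $\{x_1,\dots,x_k\}\to A$. The assignment $s(a/x)$ has domain $\mathrm{dom}(s)\cup\{x\}$, maps $x$ to $a$ and agrees with $s$ elsewhere. For $F\colon X\to A$, $X(F/x)=\{s(F(s)/x)\mid s\in X\}$, and $X(A/x)=\{s(a/x)\mid s\in X,a\in A\}$. For $W\subseteq\mathrm{dom}(X)$, $F\colon X\to A$ is $W$-independent if $F(s)=F(s')$ whenever $s,s'\in X$ agree on $\mathrm{dom}(X)\setminus W$. Semantics (with $\mathrm{Fr}(\phi)\subseteq\mathrm{dom}(X)$). (1) For a first-order literal $\phi$: $\mathfrak{A}\models_X\phi$ iff every $s\in X$ satisfies $\phi$ in $\mathfrak{A}$ in the usual sense. (2) $\mathfrak{A}\models_X\psi\wedge\phi$ iff $\mathfrak{A}\models_X\psi$ and $\mathfrak{A}\models_X\phi$. (3) $\mathfrak{A}\models_X\psi\vee\phi$ iff $X=Y\cup Z$ for some teams $Y,Z$ with $\mathfrak{A}\models_Y\psi$ and $\mathfrak{A}\models_Z\phi$. (4) $\mathfrak{A}\models_X\exists v\psi$ iff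 $\mathfrak{A}\models_{X(F/v)}\psi$ for some $F\colon X\to A$. (5) $\mathfrak{A}\models_X\forall v\psi$ iff $\mathfrak{A}\models_{X(A/v)}\psi$. (6) $\mathfrak{A}\models_X\exists v/W\psi$ iff $\mathfrak{A}\models_{X(F/v)}\psi$ for some $W$-independent $F\colon X\to A$. (7) $\mathfrak{A}\models_X{=}(t_1,\dots,t_n)$ iff any $s,s'\in X$ that give equal values to each of $t_1,\dots,t_{n-1}$ give equal values to $t_n$. (8) $\mathfrak{A}\models_X\neg{=}(t_1,\dots,t_n)$ iff $X=\emptyset$. A sentence $\phi$ is true in $\mathfrak{A}$, $\mathfrak{A}\models\phi$, if $\mathfrak{A}\models_{\{\emptyset\}}\phi$, where $\{\emptyset\}$ is the team consisting of the empty assignment. *)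

(* Defs.v *)
From HB Require Import structures.
From mathcomp Require Import all_boot.
From mathcomp Require Import boolp classical_sets functions cardinality.

Set Implicit Arguments.
Unset Strict Implicit.
Unset Printing Implicit Defensive.

Inductive var := vx | vy.

Definition bool_of_var (v : var) : bool := if v is vx then true else false.
Definition var_of_bool (b : bool) : var := if b then vx else vy.
Lemma bool_of_varK : cancel bool_of_var var_of_bool. Proof. by case. Qed.

HB.instance Definition _ := Finite.copy var (can_type bool_of_varK).

Record vocabulary := Vocabulary {
  symbol : Type;
  arity : symbol -> nat;
  arity_le2 : forall R, arity R <= 2 }.

Record structure (tau : vocabulary) := Structure {
  carrier :> Type;
  carrier_nonempty : inhabited carrier;
  interp : forall R : symbol tau, (arity R).-tuple carrier -> Prop }.

Definition finite_structure tau (M : structure tau) : Prop :=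
  finite_set [set: M]%classic.

Inductive atom (tau : vocabulary) :=
  | AEq of var & var
  | ARel (R : symbol tau) of (arity R).-tuple var.

Inductive D2 (tau : vocabulary) :=
  | DPos of atom tau
  | DNeg of atom tau
  | DDep of var & var
  | DNDep of var & var
  | DConst of var
  | DNConst of var
  | DAnd of D2 tau & D2 tau
  | DOr of D2 tau & D2 tau
  | DAll of var & D2 tau
  | DEx of var & D2 tau.

Inductive IF2 (tau : vocabulary) :=
  | IPos of atom tau
  | INeg of atom tau
  | IAnd of IF2 tau & IF2 tau
  | IOr of IF2 tau & IF2 tau
  | IAll of var & IF2 tau
  | IEx of var & {set var} & IF2 tau.

Definition atom_fv tau (a : atom tau) : {set var} :=
  match a with
  | AEq t1 t2 => [set t1; t2]%SET
  | ARel _ ts => [set t in ts]%SET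
  end.

Fixpoint D2_fv tau (phi : D2 tau) : {set var} :=
  match phi with
  | DPos a | DNeg a => atom_fv a
  | DDep t1 t2 | DNDep t1 t2 => [set t1; t2]%SET
  | DConst t | DNConst t => [set t]%SET
  | DAnd p q | DOr p q => D2_fv p :|: D2_fv q
  | DAll v p | DEx v p => D2_fv p :\ v
  end.

Fixpoint IF2_fv tau (phi : IF2 tau) : {set var} :=
  match phi with
  | IPos a | INeg a => atom_fv a
  | IAnd p q | IOr p q => IF2_fv p :|: IF2_fv q
  | IAll v p => IF2_fv p :\ v
  | IEx v W p => W :|: (IF2_fv p :\ v)
  end.

Definition D2_sentence tau (phi : D2 tau) : Prop := D2_fv phi = finset.set0.
Definition IF2_sentence tau (phi : IF2 tau) : Prop := IF2_fv phi = finset.set0.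

(* An assignment is a partial map: its domain is the set of variables that are
   not sent to None. *)
Definition assignment (A : Type) := var -> option A.

Definition empty_assignment A : assignment A := fun=> None.

Definition update A (s : assignment A) (v : var) (a : A) : assignment A :=
  fun u => if u == v then Some a else s u.

Definition supplement A (X : set (assignment A)) (v : var)
    (F : assignment A -> A) : set (assignment A) :=
  [set update s v (F s) | s in X]%classic.

Definition duplicate A (X : set (assignment A)) (v : var) :
    set (assignment A) :=
  [set s' | exists s a, X s /\ s' = update s v a]%classic.

(* Only the values of F on X matter; as carriers are nonempty, every map from X
   to A is the restriction of such an F. *)
Definition independent A (D W : {set var}) (X : set (assignment A))
    (F : assignment A -> A) : Prop :=
  forall s s', X s -> X s' ->
    (forall u, u \in D :\: W -> s u = s' u) -> F s = F s'.

Definition dependence A (X : set (assignment A)) (ts : seq var) (t : var) :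
    Prop :=
  forall s s', X s -> X s' ->
    (forall u, u \in ts -> s u = s' u) -> s t = s' t.

Definition atom_true tau (M : structure tau) (s : assignment M)
    (a : atom tau) : Prop :=
  match a with
  | AEq t1 t2 => exists m : M, s t1 = Some m /\ s t2 = Some m
  | ARel R ts => exists ms : (arity R).-tuple M,
      (forall i, s (tnth ts i) = Some (tnth ms i)) /\ interp ms
  end.

Fixpoint D2_sat tau (M : structure tau) (X : set (assignment M))
    (phi : D2 tau) : Prop :=
  match phi with
  | DPos a => forall s, X s -> atom_true s a
  | DNeg a => forall s, X s -> ~ atom_true s a
  | DDep t1 t2 => dependence X [:: t1] t2
  | DConst t => dependence X [::] t
  | DNDep _ _ | DNConst _ => X = set0
  | DAnd p q => D2_sat X p /\ D2_sat X q
  | DOr p q => exists Y Z : set (assignment M),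
      [/\ X = (Y `|` Z)%classic, D2_sat Y p & D2_sat Z q]
  | DAll v p => D2_sat (duplicate X v) p
  | DEx v p => exists F : assignment M -> M, D2_sat (supplement X v F) p
  end.

(* D is the domain of the team X. It has to be carried along because it is not
   determined by X when X is empty. *)
Fixpoint IF2_sat tau (M : structure tau) (D : {set var})
    (X : set (assignment M)) (phi : IF2 tau) : Prop :=
  match phi with
  | IPos a => forall s, X s -> atom_true s a
  | INeg a => forall s, X s -> ~ atom_true s a
  | IAnd p q => IF2_sat D X p /\ IF2_sat D X q
  | IOr p q => exists Y Z : set (assignment M),
      [/\ X = (Y `|` Z)%classic, IF2_sat D Y p & IF2_sat D Z q]
  | IAll v p => IF2_sat (v |: D) (duplicate X v) p
  | IEx v W p => exists F : assignment M -> M,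
      independent D W X F /\ IF2_sat (v |: D) (supplement X v F) p
  end.

Definition D2_true tau (M : structure tau) (phi : D2 tau) : Prop :=
  D2_sat [set @empty_assignment M]%classic phi.

Definition IF2_true tau (M : structure tau) (phi : IF2 tau) : Prop :=
  IF2_sat finset.set0 [set @empty_assignment M]%classic phi.

(* Main.v *)
Require Import Defs.
From mathcomp Require Import all_boot.
From mathcomp Require Import perm.
From mathcomp Require Import boolp classical_sets functions cardinality.
From mathcomp Require Import finset.

(* On a team with domain D, =(t1,t2) says that t1 can be reset to the value of
   t2 by a choice that does not see t2, and =(t) that the other variable can be
   reset to the value of t by a choice that sees nothing.

   For strictness, IF2 can say "every R-row is included in some S-row".  Take
   vertices a_i, c_i and a relation r on the indices, with R(a_i, c_j) and
   S(c_i, c_j) given by r, and with R(a_i, a_i), S(c_i, a_i) tying a_i to c_i.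
   If a D2 sentence holds in all these structures, colour every pair of vertices
   by its atoms and by the teams (one for each subformula) that contain it.  The
   clauses of the semantics of D2 are about the colours of the pairs through a
   single vertex u, and are invariant under a permutation of these pairs.  There
   are more relations r than ways to prescribe, for every vertex, how many times
   it sees each colour on the pairs (a_i, c_j); so two relations r1 <> r2 agree
   on all these numbers.  Taking the pairs (a_i, c_j) from r1 and the others
   from r2 then gives a structure where R comes from r1, S from r2, and the D2
   sentence still holds, whence r1 is included in r2, and conversely. *)

Set Implicit Arguments.
Unset Strict Implicit.
Unset Printing Implicit Defensive.

(** * Variables, updates and domains of teams *)

Definition other (v : var) : var := if v is vx then vy else vx.

Lemma other_neq v : other v != v. Proof. by case: v. Qed.

Lemma var_other v w : (v == other w) = (v != w).
Proof. by case: v; case: w. Qed.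

Lemma updateE A (s : assignment A) v a : update s v a v = Some a.
Proof. by rewrite /update eqxx. Qed.

Lemma update_other A (s : assignment A) v a u :
  u != v -> update s v a u = s u.
Proof. by rewrite /update => /negPf ->. Qed.

Definition has_domain A (D : {set var}) (X : set (assignment A)) : Prop :=
  forall s, X s -> forall u, (u \in D) = isSome (s u).

Lemma has_domain_sub A D (X Y : set (assignment A)) :
  (forall s, Y s -> X s) -> has_domain D X -> has_domain D Y.
Proof. by move=> YX DX s /YX /DX. Qed.

Lemma has_domain_update A D (X : set (assignment A)) s v a :
  has_domain D X -> X s -> forall u, (u \in v |: D) = isSome (update s v a u).
Proof.
move=> DX Xs u; rewrite in_setU1 /update.
by case: eqP => //= _; apply: DX.
Qed.

Lemma has_domain_duplicate A D (X : set (assignment A)) v :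
  has_domain D X -> has_domain (v |: D) (duplicate X v).
Proof. by move=> DX _ [s [a [Xs ->]]] u; apply: has_domain_update Xs u. Qed.

Lemma has_domain_supplement A D (X : set (assignment A)) v F :
  has_domain D X -> has_domain (v |: D) (supplement X v F).
Proof. by move=> DX _ [s Xs <-] u; apply: has_domain_update Xs u. Qed.

(** Assignments of a team with domain [D] that agree on [D] are equal as partial maps. *)
Lemma independent_set0 A D (X : set (assignment A)) F :
  has_domain D X -> independent D set0 X F.
Proof.
move=> DX s s' Xs Xs' ss'; congr F; apply/funext => u.
have [uD|uD] := boolP (u \in D); first by apply: ss'; rewrite setD0.
have := DX _ Xs u; have := DX _ Xs' u; rewrite (negPf uD).
by case: (s u) (s' u) => [?|] [?|].
Qed.

(** * Translation of D2 into IF2 *)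

(** The domain [D] is carried along because constancy must slash all of it. A negated dependence
    atom becomes a literal that only the empty team satisfies. *)
Fixpoint D2_to_IF2 tau (D : {set var}) (phi : D2 tau) : IF2 tau :=
  match phi with
  | DPos a => IPos a
  | DNeg a => INeg a
  | DDep t1 t2 =>
      if t1 == t2 then IPos (AEq tau t1 t1)
      else IEx t1 [set t2]%SET (IPos (AEq tau t1 t2))
  | DConst t => IEx (other t) D (IPos (AEq tau (other t) t))
  | DNDep t _ | DNConst t => INeg (AEq tau t t)
  | DAnd p q => IAnd (D2_to_IF2 D p) (D2_to_IF2 D q)
  | DOr p q => IOr (D2_to_IF2 D p) (D2_to_IF2 D q)
  | DAll v p => IAll v (D2_to_IF2 (v |: D) p)
  | DEx v p => IEx v set0 (D2_to_IF2 (v |: D) p)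
  end.

Lemma D2_to_IF2_fv tau (phi : D2 tau) (D : {set var}) :
  D2_fv phi \subset D -> IF2_fv (D2_to_IF2 D phi) \subset D.
Proof.
elim: phi D => [a|a|t1 t2|t1 t2|t|t|p IHp q IHq|p IHp q IHq|v p IHp|v p IHp] D //=.
- have [->|t12] := eqVneq t1 t2; first by [].
  rewrite /= !subUset => /andP[t1D t2D].
  by rewrite t2D subDset !subUset !sub1set !inE eqxx -!sub1set t2D orbT.
- by rewrite !subUset => /andP[-> _].
- by move=> tD; rewrite subUset subxx subDset setUSS.
- by move=> tD; rewrite subUset tD.
- by rewrite !subUset => /andP[/IHp -> /IHq ->].
- by rewrite !subUset => /andP[/IHp -> /IHq ->].
- by rewrite !subDset => /IHp.
- by rewrite set0U !subDset => /IHp.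
Qed.

(** The equality forces [F] to return the value of [t], so independence of [F] says exactly that
    [D :\: W] determines [t]. *)
Lemma IEx_eq_dependence tau (M : structure tau) D W (X : set (assignment M))
    v t ts :
  has_domain D X -> v != t -> t \in D -> D :\: W =i ts ->
  IF2_sat D X (IEx v W (IPos (AEq tau v t))) <-> dependence X ts t.
Proof.
move=> DX vt tD Wts; split=> /= [[F [Find Feq]] s s' Xs Xs' ss'|dep].
  have eqF r : X r -> r t = Some (F r).
    move=> Xr; have [|m] := Feq (update r v (F r)); first by exists r.
    by rewrite updateE update_other 1?eq_sym // => -[[->]].
  rewrite !eqF //; congr Some; apply: Find => // u; rewrite Wts; exact: ss'.
have [m0] := carrier_nonempty M.
exists (fun s => odflt m0 (s t)); split=> [s s' Xs Xs' ss'|_ [s Xs <-]].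
  by rewrite (dep s s') // => u; rewrite -Wts; exact: ss'.
have := DX _ Xs t; rewrite tD; case E: (s t) => [m|] // _.
by exists m; rewrite updateE update_other 1?eq_sym.
Qed.

Lemma D2_to_IF2_sat tau (M : structure tau) (phi : D2 tau) D
    (X : set (assignment M)) :
  has_domain D X -> D2_fv phi \subset D ->
  D2_sat X phi <-> IF2_sat D X (D2_to_IF2 D phi).
Proof.
have empty D' Y t : @has_domain M D' Y -> t \in D' ->
    Y = classical_sets.set0 <-> forall s, Y s -> ~ atom_true s (AEq tau t t).
  move=> DY tD; split=> [->//|Y0]; apply/classical_sets.seteqP; split=> // s Ys.
  have := DY _ Ys t; rewrite tD; case E: (s t) => [m|] // _.
  by case: (Y0 _ Ys); exists m.
elim: phi D X => [a|a|t1 t2|t1 t2|t|t|p IHp q IHq|p IHp q IHq|v p IHp|v p IHp]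
  D X DX.
- by [].
- by [].
- rewrite [D2_fv _]/= [D2_to_IF2 _ _]/= subUset !sub1set => /andP[t1D t2D].
  have [<-|t12] := eqVneq t1 t2.
    split=> [_ s Xs|_ s s' Xs Xs' /(_ t1)]; last by rewrite inE eqxx => ->.
    have := DX _ Xs t1; rewrite t1D /=.
    by case: (s t1) => [m|] // _; exists m.
  (* Two distinct variables exhaust [D], so removing [t2] leaves exactly [t1]. *)
  apply: iff_sym; apply: IEx_eq_dependence => // u; rewrite !inE.
  by case: t1 t2 u t12 t1D t2D => [] [] [] //= _ -> ->.
- by rewrite /= subUset !sub1set => /andP[t1D _]; exact: (empty D).
- rewrite [D2_fv _]/= [D2_to_IF2 _ _]/= sub1set => tD.
  apply: iff_sym; apply: IEx_eq_dependence => //; first exact: other_neq.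
  by move=> u; rewrite setDv !inE.
- by rewrite /= sub1set => tD; exact: (empty D).
- rewrite /= subUset => /andP[pD qD].
  by rewrite (IHp D X) // (IHq D X).
- rewrite /= subUset => /andP[pD qD].
  have dom Y Z : X = (Y `|` Z)%classic -> has_domain D Y /\ has_domain D Z.
    by move=> XYZ; split; apply: has_domain_sub DX => s; rewrite XYZ; [left|right].
  split=> -[Y [Z [XYZ Yp Zq]]]; exists Y, Z; have [DY DZ] := dom _ _ XYZ.
    by split=> //; [exact/(IHp D Y DY pD)|exact/(IHq D Z DZ qD)].
  by split=> //; [exact/(IHp D Y DY pD)|exact/(IHq D Z DZ qD)].
- rewrite /= subDset => pD.
  by apply: IHp => //; apply: has_domain_duplicate.
- rewrite /= subDset => pD.
  have IH F := IHp (v |: D) (supplement X v F) (has_domain_supplement DX) pD.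
  split=> [[F /IH pF]|[F [_ /IH pF]]]; exists F => //.
  by split=> //; exact: independent_set0.
Qed.

Lemma D2_to_IF2_true tau (M : structure tau) (phi : D2 tau) :
  D2_sentence phi ->
  D2_true M phi <-> IF2_true M (D2_to_IF2 set0 phi).
Proof.
move=> phi0; apply: D2_to_IF2_sat; last by rewrite phi0.
by move=> _ -> u; rewrite in_set0.
Qed.

(** * Witnessing families of teams *)

(* Index of the proper subformula occurrences; None in [option (inner phi)]
   stands for phi itself. *)
Fixpoint inner tau (phi : D2 tau) : finType :=
  match phi with
  | DAnd p q | DOr p q => (option (inner p) + option (inner q))%type
  | DAll _ p | DEx _ p => option (inner p)
  | _ => void
  end.

(* By downward closure it is enough that the teams of the subformulas contain,
   instead of being equal to, the teams prescribed by the semantics. *)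
Fixpoint witness tau (M : structure tau) (phi : D2 tau) :
    (option (inner phi) -> set (assignment M)) -> Prop :=
  match phi return (option (inner phi) -> set (assignment M)) -> Prop with
  | DPos a => fun T => forall s, T None s -> atom_true s a
  | DNeg a => fun T => forall s, T None s -> ~ atom_true s a
  | DDep t1 t2 => fun T => dependence (T None) [:: t1] t2
  | DConst t => fun T => dependence (T None) [::] t
  | DNDep _ _ | DNConst _ => fun T => forall s, ~ T None s
  | DAnd p q => fun T =>
      (forall s, T None s -> T (Some (inl None)) s /\ T (Some (inr None)) s) /\
      witness (fun o => T (Some (inl o))) /\ witness (fun o => T (Some (inr o)))
  | DOr p q => fun T =>
      (forall s, T None s -> T (Some (inl None)) s \/ T (Some (inr None)) s) /\
      witness (fun o => T (Some (inl o))) /\ witness (fun o => T (Some (inr o)))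
  | DAll v p => fun T =>
      (forall s a, T None s -> T (Some None) (update s v a)) /\
      witness (fun o => T (Some o))
  | DEx v p => fun T =>
      (forall s, T None s -> exists a, T (Some None) (update s v a)) /\
      witness (fun o => T (Some o))
  end.
Arguments witness {tau} M phi T.

Lemma D2_sat_witness tau (M : structure tau) (phi : D2 tau) T X :
  witness M phi T -> (forall s, X s -> T None s) -> D2_sat X phi.
Proof.
elim: phi X T => [a|a|t1 t2|t1 t2|t|t|p IHp q IHq|p IHp q IHq|v p IHp|v p IHp]
  X T /=.
- by move=> wT XT s /XT /wT.
- by move=> wT XT s /XT /wT.
- by move=> wT XT s s' /XT Ts /XT; exact: wT.
- by move=> wT XT; apply/classical_sets.seteqP; split=> // s /XT /wT.
- by move=> wT XT s s' /XT Ts /XT; exact: wT.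
- by move=> wT XT; apply/classical_sets.seteqP; split=> // s /XT /wT.
- move=> [wT [wp wq]] XT; split; first by apply: IHp wp _ => s /XT /wT [].
  by apply: IHq wq _ => s /XT /wT [].
- move=> [wT [wp wq]] XT.
  (* The split of [X] must be exact, so the larger teams are cut down to [X]. *)
  exists (X `&` T (Some (inl None)))%classic, (X `&` T (Some (inr None)))%classic.
  split; last 2 first.
  + by apply: IHp wp _ => s [].
  + by apply: IHq wq _ => s [].
  apply/classical_sets.seteqP; split=> [s Xs|s [[]|[]]//].
  by case: (wT _ (XT _ Xs)); [left|right].
- move=> [wT wp] XT; apply: IHp wp _ => _ [s [a [/XT Ts ->]]]; exact: wT.
- move=> [wT wp] XT.
  have /choice[F FP] : forall s, exists a,
      T None s -> T (Some None) (update s v a).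
    move=> s; have [m0] := carrier_nonempty M.
    have [/wT[a Ta]|nT] := pselect (T None s); first by exists a.
    by exists m0.
  by exists F; apply: IHp wp _ => _ [s /XT Ts <-]; exact: FP.
Qed.

Lemma D2_sat_has_witness tau (M : structure tau) (phi : D2 tau) X :
  D2_sat X phi -> exists2 T, witness M phi T & T None = X.
Proof.
elim: phi X => [a|a|t1 t2|t1 t2|t|t|p IHp q IHq|p IHp q IHq|v p IHp|v p IHp]
  X /=; try by [exists (fun=> X)
    | move=> ->; exists (fun=> classical_sets.set0) => // s []].
- move=> [/IHp[Tp wp Tp0] /IHq[Tq wq Tq0]].
  exists (fun o => match o with
    None => X | Some (inl o) => Tp o | Some (inr o) => Tq o end) => //.
  by split=> // s; rewrite Tp0 Tq0.
- move=> [Y [Z [XYZ /IHp[Tp wp Tp0] /IHq[Tq wq Tq0]]]].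
  exists (fun o => match o with
    None => X | Some (inl o) => Tp o | Some (inr o) => Tq o end) => //.
  by split=> // s; rewrite Tp0 Tq0 XYZ.
- move=> /IHp[Tp wp Tp0].
  exists (fun o => if o is Some o then Tp o else X) => //.
  by split=> // s a Xs; rewrite Tp0; exists s, a.
- move=> [F /IHp[Tp wp Tp0]].
  exists (fun o => if o is Some o then Tp o else X) => //.
  by split=> // s Xs; exists (F s); rewrite Tp0; exists s.
Qed.

(** * Transfer along permutations that fix one variable *)

(* [None] (an unassigned variable) is treated as an additional element. *)
Definition twist A (h : option A -> option A -> option A) (w : var)
    (s : assignment A) : assignment A :=
  fun t => if t == w then s w else h (s w) (s t).

Lemma twistE A h w (s : assignment A) : twist h w s w = s w.
Proof. by rewrite /twist eqxx. Qed.

Lemma twist_other A h w t (s : assignment A) :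
  t != w -> twist h w s t = h (s w) (s t).
Proof. by rewrite /twist => /negPf ->. Qed.

Lemma twist_update A (h : option A -> option A -> option A) v s a b :
  h (s (other v)) (Some a) = Some b ->
  twist h (other v) (update s v a) = update (twist h (other v) s) v b.
Proof.
move=> hab; apply/funext => t; rewrite /twist /update var_other.
rewrite (negPf (other_neq v)).
by have [_|_] := eqVneq t v.
Qed.

Section Transfer.
Variables (tau : vocabulary) (A : Type) (A0 : inhabited A).
Variables IM IN : forall R : symbol tau, (arity R).-tuple A -> Prop.
Let M := Structure A0 IM.
Let N := Structure A0 IN.
Variables (h : option A -> option A -> option A).
Hypothesis hK : forall u, bijective (h u).
Hypothesis h0 : forall u, h u None = None.
Hypothesis hid : forall u, h u u = u.
Hypothesis hrel : forall R (ts : (arity R).-tuple var) w (s : assignment A),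
  @atom_true tau N s (ARel ts) <-> @atom_true tau M (twist h w s) (ARel ts).

Let hsome u a : exists b, h u (Some a) = Some b.
Proof.
case E: (h u (Some a)) => [b|]; first by exists b.
by have := bij_inj (hK u); rewrite -(h0 u) in E => /(_ _ _ E).
Qed.

Let hsurj u b : exists a, h u (Some a) = Some b.
Proof.
have [g _ hg] := hK u; case E: (g (Some b)) => [a|]; first by exists a; rewrite -E hg.
by have := hg (Some b); rewrite E h0.
Qed.

(** For equality: [h u] is injective and fixes [u], so it sends nothing else to [u]; and two
    variables different from [w] coincide. *)
Lemma twist_atom (a : atom tau) w (s : assignment A) :
  @atom_true tau N s a <-> @atom_true tau M (twist h w s) a.
Proof.
case: a => [t1 t2|R ts] /=; last exact: hrel.
have inj u := bij_inj (hK u).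
have eqw t : t != w -> forall m,
    (s w = Some m /\ s t = Some m) <-> (s w = Some m /\ h (s w) (s t) = Some m).
  move=> tw m; split=> -[sw]; rewrite sw => st; split=> //.
    by rewrite st hid.
  by apply: (inj (Some m)); rewrite st hid.
have [->|t1w] := eqVneq t1 w; have [->|t2w] := eqVneq t2 w; rewrite ?twistE ?twist_other //.
- by split=> -[m /(eqw _ t2w)]; exists m.
- split=> -[m [st sw]]; exists m; have := conj sw st;
  by move=> /(eqw _ t1w)[].
- have [->|t12] := eqVneq t1 t2; last by move: t12 t1w t2w; case: t1 t2 w {eqw} => [] [] [].
  split=> -[m [st _]]; first by rewrite st; have [b ->] := hsome (s w) m; exists b.
  move: st; case: (s t2) => [b|]; last by rewrite h0.
  by exists b.
Qed.

(* Every clause of [witness] fixes the value [u] of one variable and compares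
   the assignments obtained by varying the other one, which [h u] permutes. *)
Lemma witness_twist (phi : D2 tau) (TM TN : option (inner phi) -> set (assignment A)) :
  (forall o w s, TN o s <-> TM o (twist h w s)) ->
  witness M phi TM -> witness N phi TN.
Proof.
elim: phi TM TN => [a|a|t1 t2|t1 t2|t|t|p IHp q IHq|p IHp q IHq|v p IHp|v p IHp]
  TM TN TT /=.
- by move=> wT s /(TT _ vx) /wT /twist_atom.
- by move=> wT s /(TT _ vx) /wT nT /(twist_atom _ vx).
- have [->|t12] := eqVneq t1 t2.
    by move=> _ s s' _ _ /(_ t2); rewrite inE eqxx; exact.
  (* Twisting at [t1] keeps its common value and applies one injective map to both values of
     [t2]. *)
  move=> wT s s' /(TT _ t1) Ts /(TT _ t1) Ts' /(_ t1).
  rewrite inE eqxx => /(_ isT) ss'.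
  have := wT _ _ Ts Ts'; rewrite !twist_other 1?eq_sym // -ss'.
  move=> H; apply: (bij_inj (hK (s t1))); apply: H => u.
  by rewrite inE => /eqP ->; rewrite !twistE.
- by move=> wT s /(TT _ vx) /wT.
- move=> wT s s' /(TT _ t) Ts /(TT _ t) Ts' _.
  by have := wT _ _ Ts Ts'; rewrite !twistE; exact.
- by move=> wT s /(TT _ vx) /wT.
- move=> [wT [wp wq]]; split; last first.
    by split; [apply: IHp wp => o|apply: IHq wq => o]; exact: TT.
  by move=> s /(TT _ vx)/wT[? ?]; split; apply/(TT _ vx).
- move=> [wT [wp wq]]; split; last first.
    by split; [apply: IHp wp => o|apply: IHq wq => o]; exact: TT.
  by move=> s /(TT _ vx)/wT[?|?]; [left|right]; apply/(TT _ vx).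
- move=> [wT wp]; split; last by apply: IHp wp => o; exact: TT.
  move=> s a /(TT _ (other v)) Ts.
  have [b hab] := hsome (s (other v)) a.
  by apply/(TT _ (other v)); rewrite (twist_update hab); exact: wT.
- move=> [wT wp]; split; last by apply: IHp wp => o; exact: TT.
  move=> s /(TT _ (other v)) /wT[b Tb].
  (* Surjectivity pulls the choice [b] made in [M] back to a choice in [N]. *)
  have [a hab] := hsurj (s (other v)) b.
  by exists a; apply/(TT _ (other v)); rewrite (twist_update hab).
Qed.

End Transfer.

(** * The separating sentence *)

Definition edge_vocabulary : vocabulary :=
  @Vocabulary bool (fun=> 2) (fun=> leqnn 2).

(** With [vy] hidden, the new value of [vx] depends on the old one alone, so a single row must serve
    all values of [vy]. *)
Definition row_inclusion : IF2 edge_vocabulary :=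
  IAll vx (IAll vy (IOr (INeg (@ARel edge_vocabulary false [tuple vx; vy]))
    (IEx vx [set vy]%SET (IPos (@ARel edge_vocabulary true [tuple vx; vy]))))).

Lemma row_inclusion_sentence : IF2_sentence row_inclusion.
Proof.
by apply/setP => v; rewrite !inE /=; case: v; rewrite /= ?inE.
Qed.

Definition edge (M : structure edge_vocabulary) (b : bool) (u v : M) : Prop :=
  @interp edge_vocabulary M b [tuple u; v].

Definition assign A (w : var) (u v : A) : assignment A :=
  fun t => Some (if t == w then u else v).

Lemma atom_edge (M : structure edge_vocabulary) b (u v : M) (s : assignment M) :
  s vx = Some u -> s vy = Some v ->
  atom_true s (@ARel edge_vocabulary b [tuple vx; vy]) <-> edge b u v.
Proof.
move=> su sv; split=> [/= [ms [sms]]|uv].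
  have := sms (@Ordinal 2 0 isT); have := sms (@Ordinal 2 1 isT).
  rewrite /tnth /= su sv; move: ms {sms} => [[|m [|m' []]] //= sz] [->] [->].
  by rewrite /edge; congr interp; apply: val_inj.
exists [tuple u; v]; split=> // i.
by case: i => [[|[|]]] //= lti; rewrite /tnth /= ?su ?sv.
Qed.

Lemma row_inclusion_true (M : structure edge_vocabulary) :
  IF2_true M row_inclusion <->
  forall u : M, exists c : M, forall v, edge false u v -> edge true c v.
Proof.
rewrite /IF2_true /=; set X := duplicate _ vy.
have XE s : X s <-> exists u v, s = assign vx u v.
  split=> [[_ [v [[_ [u [-> ->]]] ->]]]|[u [v ->]]].
    by exists u, v; apply/funext => -[].
  exists (update (@empty_assignment M) vx u), v; split.
    by exists (@empty_assignment M), u.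
  by apply/funext => -[].
split=> [[Y [Z [XYZ Yneg [F [Find FS]]]]] u|inc].
  have ZP v : edge false u v -> Z (assign vx u v).
    move=> uv; have : X (assign vx u v) by apply/XE; exists u, v.
    rewrite XYZ => -[/Yneg[]|//].
    by apply/(@atom_edge M false u v).
  (* [F] is constrained only on [Z], which may miss a vertex with an empty row; such a row is
     included in any other. *)
  have [[v0 uv0]|nov] := pselect (exists v, edge false u v); last first.
    by exists u => v uv; case: nov; exists v.
  exists (F (assign vx u v0)) => v uv.
  have -> : F (assign vx u v0) = F (assign vx u v).
    by apply: Find; [exact: ZP|exact: ZP|case; rewrite ?inE].
  have /(atom_edge true) H := FS _ (ex_intro2 _ _ _ (ZP v uv) erefl).
  exact: H.
have [f fP] := choice inc.
pose R := [set s : assignment M |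
  atom_true s (@ARel edge_vocabulary false [tuple vx; vy])]%classic.
exists (X `\` R)%classic, (X `&` R)%classic; split.
- apply/classical_sets.seteqP; split=> [s Xs|s [[]|[]]//].
  by have [?|?] := pselect (R s); [right|left].
- by move=> s [].
have [m0] := carrier_nonempty M.
exists (fun s => f (odflt m0 (s vx))); split.
  by move=> s s' _ _ ss'; rewrite ss' // !inE.
move=> _ [_ [/XE[u [v ->]] /(atom_edge _ (u := u) (v := v)) uv] <-].
by apply/(atom_edge true (u := f u) (v := v)) => //; apply: fP; exact: uv.
Qed.

(** * Incidence structures *)

Definition vertex n : Type := ('I_n.+1 * bool)%type.

Definition edge_set n := {ffun 'I_n.+1 * 'I_n.+1 -> bool}.

(* (i, false) and (i, true) are a_i and c_i; b = false is R, b = true is S. *)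
Definition incidence_edge n (r1 r2 : edge_set n) (b : bool) (u v : vertex n) : bool :=
  (u.2 == b) &&
  (if v.2 then (if u.2 then r2 else r1) (u.1, v.1) else u.1 == v.1).

Definition incidence n (r1 r2 : edge_set n) : structure edge_vocabulary :=
  @Structure edge_vocabulary (vertex n) (inhabits (ord0, false))
    (fun b ms => incidence_edge r1 r2 b
       (tnth ms (@Ordinal 2 0 isT)) (tnth ms (@Ordinal 2 1 isT))).

Lemma incidence_finite n (r1 r2 : edge_set n) :
  finite_structure (incidence r1 r2).
Proof. exact: (@finite_finset ('I_n.+1 * bool)%type). Qed.

(** Only [c_i] has an [S]-edge to [a_i], so the row of [a_i] can only be included in that of [c_i].
    The [R]-row of [c_i] is empty. *)
Lemma row_inclusion_incidence n (r1 r2 : edge_set n) :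
  IF2_true (incidence r1 r2) row_inclusion <-> forall p, r1 p -> r2 p.
Proof.
apply: (iff_trans (row_inclusion_true _)); split=> [inc [i j]|sub [i [] ]].
- have [[k b] kP] := inc (i, false).
  have := kP (i, false); rewrite /edge /= /incidence_edge /tnth /= eqxx.
  move=> /(_ isT)/andP[/eqP bT /eqP ki]; move: kP; rewrite bT ki => kP rij.
  by have := kP (j, true); rewrite /edge /= /incidence_edge /tnth /= => /(_ rij).
- by exists (i, true).
- exists (i, true) => -[j []]; rewrite /edge /= /incidence_edge /tnth //=.
  exact: sub.
Qed.

Lemma incidence_atom n (r1 r2 r1' r2' : edge_set n) b ts (s : assignment (vertex n)) :
  (forall t t' u v, s t = Some u -> s t' = Some v ->
     incidence_edge r1 r2 b u v = incidence_edge r1' r2' b u v) ->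
  @atom_true _ (incidence r1 r2) s (@ARel edge_vocabulary b ts) <->
  @atom_true _ (incidence r1' r2') s (@ARel edge_vocabulary b ts).
Proof.
move=> rr; split=> /= -[ms [sms H]]; exists ms; split=> //; move: H.
  by rewrite (rr _ _ _ _ (sms _) (sms _)).
by rewrite (rr _ _ _ _ (sms _) (sms _)).
Qed.

(** * Colours, profiles and the hybrid structure *)

(** These are the assignments on which the hybrid follows [r1]; a partial assignment is not one of
    them. *)
Definition cross n (s : assignment (vertex n)) : bool :=
  if (s vx, s vy) is (Some u, Some v) then u.2 != v.2 else false.

Lemma cross_assign n w (u v : vertex n) : cross (assign w u v) = (u.2 != v.2).
Proof. by case: w; rewrite /cross /= // eq_sym. Qed.

Section Hybrid.
Variables (n : nat) (phi : D2 edge_vocabulary).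

(** Relational atoms are indexed along with the subformulas, so that equal colours also agree on
    edges. *)
Definition team_index : finType :=
  (option (inner phi) + bool * 2.-tuple var)%type.

(** The [var] component says which variable takes the first vertex. The type depends on [phi] but
    not on [n], as the counting requires. *)
Definition colour_type : finType := {ffun team_index * var -> bool}.

Definition extended_team (r : edge_set n)
    (T : option (inner phi) -> set (assignment (vertex n))) (k : team_index) :
    set (assignment (vertex n)) :=
  match k with
  | inl o => T o
  | inr (b, ts) =>
      fun s => @atom_true _ (incidence r r) s (@ARel edge_vocabulary b ts)
  end.

Definition colour r T (u v : vertex n) : colour_type :=
  [ffun k => `[< extended_team r T k.1 (assign k.2 u v) >]].

Definition opposite (u : vertex n) (j : 'I_n.+1) : vertex n := (j, ~~ u.2).

Definition profile_type : finType :=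
  {ffun 'I_n.+1 * bool -> {ffun colour_type -> 'I_n.+2}}.

Definition colour_row r T (u : vertex n) : n.+1.-tuple colour_type :=
  [tuple colour r T u (opposite u j) | j < n.+1].

Definition profile r T : profile_type :=
  [ffun u => [ffun c => inord (count_mem c (colour_row r T u))]].

(** Equal counts of every colour make the two colour rows permutations of each other. *)
Lemma profile_perm r1 r2 T1 T2 : profile r1 T1 = profile r2 T2 ->
  exists p : vertex n -> 'S_n.+1, forall u j,
    colour r1 T1 u (opposite u j) = colour r2 T2 u (opposite u (p u j)).
Proof.
move=> pp.
suff /choice[p pP] : forall u, exists p : 'S_n.+1, forall j,
    colour r1 T1 u (opposite u j) = colour r2 T2 u (opposite u (p j)).
  by exists p.
move=> u.
have /tuple_permP[p rowp] : perm_eq (colour_row r1 T1 u) (colour_row r2 T2 u).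
  apply/allP => c _ /=; move/ffunP/(_ u)/ffunP/(_ c): pp.
  (* A count is at most [n.+1], so [inord] in [profile] loses nothing. *)
  have count_lt (t : n.+1.-tuple colour_type) : count_mem c t < n.+2.
    by rewrite ltnS -[X in _ <= X](size_tuple t) count_size.
  by rewrite !ffunE => /(congr1 (@nat_of_ord _)); rewrite !inordK // => ->.
exists p => j; have {rowp} /val_inj rowp := rowp.
by move/(congr1 (fun t => tnth t j)): rowp; rewrite !tnth_mktuple.
Qed.

Variables (r1 r2 : edge_set n).
Variables (T1 T2 : option (inner phi) -> set (assignment (vertex n))).
Variable p : vertex n -> 'S_n.+1.
Hypothesis colourp : forall u j,
  colour r1 T1 u (opposite u j) = colour r2 T2 u (opposite u (p u j)).

Lemma colour_team k w u j :
  extended_team r1 T1 k (assign w u (opposite u j)) <->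
  extended_team r2 T2 k (assign w u (opposite u (p u j))).
Proof.
have /ffunP/(_ (k, w)) := colourp u j; rewrite !ffunE => E.
exact: asbool_eq_equiv E.
Qed.

(** A loop at [u] is an atom of every pair through [u], hence part of its colour. This matters
    because [incidence r1 r2] takes its [S]-loops from [r2] even when read on a cross assignment. *)
Lemma colour_loop b u : incidence_edge r1 r1 b u u = incidence_edge r2 r2 b u u.
Proof.
have edgeE r v : @atom_true _ (incidence r r) (assign vx u v)
    (@ARel edge_vocabulary b [tuple vx; vx]) <-> incidence_edge r r b u u.
  split=> [[ms [sms]] | uu].
    have [su] := sms (@Ordinal 2 0 isT); have [sv] := sms (@Ordinal 2 1 isT).
    by rewrite /= -su -sv.
  exists [tuple u; u]; split => // i.
  by case: i => [[|[|]]] //= lti.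
have := colour_team (inr (b, [tuple vx; vx])) vx u u.1.
rewrite /= => H; apply/idP/idP => /edgeE.
  by move=> /(_ (opposite u u.1))/H/edgeE.
by move=> /(_ (opposite u (p u u.1)))/H/edgeE.
Qed.

(** [p u] acts on the side opposite to [u]; the side of [u], with [u] itself, stays fixed, as
    equality atoms demand. *)
Definition swap (u v : option (vertex n)) : option (vertex n) :=
  match u, v with
  | Some u, Some v => if u.2 == v.2 then Some v else Some (p u v.1, v.2)
  | None, _ => v
  | _, None => None
  end.

Lemma swap_bij u : bijective (swap u).
Proof.
case: u => [u|]; last by exists id.
exists (fun v => if v is Some v then
  if u.2 == v.2 then Some v else Some ((p u)^-1%g v.1, v.2) else None).
  case=> [[j b]|] //=; have [ub|ub] := eqVneq u.2 b; first by rewrite ub eqxx.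
  by rewrite (negPf ub) /= permK.
case=> [[j b]|] //=; have [ub|ub] := eqVneq u.2 b; first by rewrite /= ub eqxx.
by rewrite /= (negPf ub) permKV.
Qed.

Definition hybrid (S1 S2 : set (assignment (vertex n))) :
    set (assignment (vertex n)) :=
  fun s => if cross s then S1 s else S2 s.

(** On cross assignments the matching of colours turns [r1]-teams into [r2]-teams; the twist fixes
    all the others. *)
Lemma hybrid_twist k w s :
  hybrid (extended_team r1 T1 k) (extended_team r2 T2 k) s <->
  extended_team r2 T2 k (twist swap w s).
Proof.
rewrite /hybrid; have [cs|ncs] := boolP (cross s).
  have [u [v sE]] : exists u v, s = assign w u v.
    move: cs; rewrite /cross; case sx: (s vx) => [u|] //.
    case sy: (s vy) => [v|] // _.
    case: w; [exists u, v|exists v, u]; apply/funext => -[] //=;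
      by rewrite ?sx ?sy.
  move: cs; rewrite sE cross_assign => uv.
  have -> : v = opposite u v.1.
    by case: u v uv {sE} => [i []] [j []].
  have -> : twist swap w (assign w u (opposite u v.1)) =
      assign w u (opposite u (p u v.1)).
    apply/funext => t; rewrite /twist /assign eqxx; case: eqVneq => //= _.
    by rewrite (_ : (u.2 == ~~ u.2) = false) //; case: (u.2).
  exact: colour_team.
suff -> : twist swap w s = s by [].
apply/funext => t; rewrite /twist; case: eqVneq => [->//|tw].
move: ncs; rewrite /cross /swap.
case: w t tw => [] [] // _; case: (s vx) => [u|]; case: (s vy) => [v|] //;
  by rewrite negbK // eq_sym => ->.
Qed.

(** [r1] enters only edges from some [a_i] to some [c_j], and [r2] only edges among the [c_i]; so,
    loops aside, each kind of assignment reads one relation. *)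
Lemma hybrid_atom b ts (s : assignment (vertex n)) :
  @atom_true _ (incidence r1 r2) s (@ARel edge_vocabulary b ts) <->
  hybrid (extended_team r1 T1 (inr (b, ts))) (extended_team r2 T2 (inr (b, ts))) s.
Proof.
rewrite /hybrid; have [cs|ncs] := boolP (cross s); apply: incidence_atom.
  move=> t t' u v st st'.
  have [uv|uv] := eqVneq u v.
    rewrite -{}uv in st' *; have := colour_loop b u; rewrite /incidence_edge.
    by case: (u.2).
  have {}uv : u.2 != v.2.
    move: cs uv; rewrite /cross.
    by case: t t' st st' => [] [] -> // [->] //; rewrite ?eqxx // eq_sym.
  by move: uv; rewrite /incidence_edge; case: (u.2); case: (v.2).
move=> t t' u v st st'.
have uv : u.2 = v.2.
  move: ncs; rewrite /cross; case: t t' st st' => [] [] -> // [->] //;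
    by rewrite negbK => /eqP.
by rewrite /incidence_edge uv; case: (v.2).
Qed.

Lemma witness_hybrid :
  witness (incidence r2 r2) phi T2 ->
  witness (incidence r1 r2) phi (fun o => hybrid (T1 o) (T2 o)).
Proof.
apply: (@witness_twist edge_vocabulary _ _ _ _ swap swap_bij).
- by case.
- by case=> [u|] //=; rewrite eqxx.
- move=> b ts w s; apply: iff_trans (hybrid_twist (inr (b, ts)) w s).
  exact: hybrid_atom.
- move=> o w s; exact: (hybrid_twist (inl o) w s).
Qed.

End Hybrid.

Lemma hybrid_true n (phi : D2 edge_vocabulary) (r1 r2 : edge_set n) T1 T2 :
  witness (incidence r2 r2) phi T2 -> T2 None (@empty_assignment _) ->
  profile r1 T1 = profile r2 T2 -> D2_true (incidence r1 r2) phi.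
Proof.
move=> w2 T2e /profile_perm[p colourp].
(* The empty assignment is not a cross one, so there the hybrid team is [T2 None]. *)
by apply: D2_sat_witness (witness_hybrid colourp w2) _ => _ ->.
Qed.

(** * Counting profiles, and the separation *)

(** With [N = n + 1] there are [2 ^ (N * N)] relations and [(N + 1) ^ (2 * N * #|C|)] profiles.
    Taking [N + 1 = 2 ^ m], the pigeonhole needs only [2 * m * #|C| < N]. *)
Lemma profile_collision (C : finType) : exists n,
  forall f : edge_set n -> {ffun 'I_n.+1 * bool -> {ffun C -> 'I_n.+2}},
  exists r1 r2, r1 != r2 /\ f r1 = f r2.
Proof.
(* This makes [m * #|C| * 2] equal to [q * (q - 1)], while [2 ^ m] is at least [(q + 1) ^ 2]. *)
pose q := (4 * #|C|).+1; pose m := q + q.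
have q_lt : q < 2 ^ q by exact: ltn_expl.
have m_bound : m * #|C| * 2 < (2 ^ m).-1.
  rewrite -ltnS prednK ?expn_gt0 // expnD.
  apply: leq_trans (leq_mul q_lt q_lt).
  have -> : m * #|C| * 2 = q * q.-1.
    by rewrite /m addnn -muln2 -!mulnA [2 * _]mulnCA [#|C| * _]mulnC.
  have le_qq : q * q.-1 <= q * q by rewrite leq_mul2l leqnSn orbT.
  rewrite mulSn mulnS addSn ltnS; apply: leq_ltn_trans le_qq _.
  by rewrite addnA -[X in X < _]add0n ltn_add2r.
have m_gt1 : 1 < 2 ^ m by rewrite -[1]/(2 ^ 0) ltn_exp2l.
exists (2 ^ m).-2 => f.
have E1 : (2 ^ m).-2.+1 = (2 ^ m).-1 by rewrite prednK // -subn1 subn_gt0.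
have E2 : (2 ^ m).-2.+2 = 2 ^ m by rewrite E1 prednK // (ltn_trans _ m_gt1).
have /injectivePn[r1 [r2 r12 fr]] : ~~ injectiveb f; last by exists r1, r2.
apply/injectiveP => /leq_card; rewrite leqNgt => /negP; apply.
rewrite !card_ffun !card_prod card_bool !card_ord E2 E1 -!expnM ltn_exp2l //.
by rewrite [#|C| * _]mulnCA mulnCA ltn_pmul2l ?mulnA // -subn1 subn_gt0.
Qed.

Lemma row_inclusion_not_D2 (psi : D2 edge_vocabulary) :
  ~ (forall M : structure edge_vocabulary, finite_structure M ->
       (IF2_true M row_inclusion <-> D2_true M psi)).
Proof.
move=> equiv; have [n coll] := profile_collision (colour_type psi).
have /choice[T TP] : forall r : edge_set n,
    exists T : option (inner psi) -> set (assignment (vertex n)),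
    witness (incidence r r) psi T /\ T None (@empty_assignment _).
  move=> r; have /equiv[+ _] := incidence_finite r r.
  case/(_ _)/D2_sat_has_witness; first exact/row_inclusion_incidence.
  by move=> T wT T0; exists T; rewrite T0.
have [r1 [r2 [/eqP r12 prof]]] := coll (fun r => profile r (T r)).
(* Equality of profiles is symmetric, so this gives both inclusions. *)
have sub r r' : profile r (T r) = profile r' (T r') -> forall p, r p -> r' p.
  move=> prof'; apply/row_inclusion_incidence/equiv.
    exact: incidence_finite.
  have [wT T0] := TP r'; exact: hybrid_true wT T0 prof'.
by apply: r12; apply/ffunP => p; apply/idP/idP; apply: sub.
Qed.

Theorem proposition3p5 :
  (forall (tau : vocabulary) (phi : D2 tau), D2_sentence phi ->
     exists phi' : IF2 tau, IF2_sentence phi' /\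
       forall M : structure tau, D2_true M phi <-> IF2_true M phi')
  /\
  (exists (tau : vocabulary) (phi : IF2 tau), IF2_sentence phi /\
     forall psi : D2 tau, D2_sentence psi ->
       ~ (forall M : structure tau, IF2_true M phi <-> D2_true M psi))
  /\
  (exists (tau : vocabulary) (phi : IF2 tau), IF2_sentence phi /\
     forall psi : D2 tau, D2_sentence psi ->
       ~ (forall M : structure tau, finite_structure M ->
            (IF2_true M phi <-> D2_true M psi))).
Proof.
split.
  move=> tau phi phi0; exists (D2_to_IF2 set0 phi); split.
    by apply/eqP; rewrite -subset0; apply: D2_to_IF2_fv; rewrite phi0.
  by move=> M; apply: D2_to_IF2_true.
split; exists edge_vocabulary, row_inclusion; split;
  try exact: row_inclusion_sentence.
  move=> psi _ equiv; apply: (@row_inclusion_not_D2 psi) => M _; exact: equiv.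
by move=> psi _; apply: row_inclusion_not_D2.
Qed.
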